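(* For every positive integer $n$, $$\sum_{\lambda \in P_{do}(n)} (-1)^{\ell(\lambda)} = \begin{cases} (-1)^k, & \text{if } n = k^2 \text{ for some positive integer } k,\\ 0, & \text{otherwise.}\end{cases}$$
   Context: $P_{do}(n)$ denotes the set of partitions of $n$ into distinct (positive) parts whose smallest part is odd. For a partition $\lambda$, $\ell(\lambda)$ denotes its number of parts. *)

(* Defs.v *)
From HB Require Import structures.
From mathcomp Require Import all_boot.

Set Implicit Arguments.
Unset Strict Implicit.
Unset Printing Implicit Defensive.

Definition is_partition (n : nat) (s : seq nat) : bool :=
  [&& sorted geq s, all (leq 1) s & sumn s == n].

Record partition_of (n : nat) : predArgType := PartitionOf {
  parts :> seq nat;
  _ : is_partition n parts
}.

HB.instance Definition _ n := [isSub for @parts n].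
HB.instance Definition _ n := [Countable of partition_of n by <:].

(* A partition of n has at most n parts, each at most n, so it is encoded
   without loss as a bounded sequence over the finite type 'I_n.+1. *)
Section Finiteness.

Variable n : nat.

Let enc (l : partition_of n) : n.-bseq 'I_n.+1 :=
  insub_bseq n [seq inord i | i <- l].

Let dec (b : n.-bseq 'I_n.+1) : option (partition_of n) :=
  insub [seq val i | i <- b].

Fact size_le_sumn (s : seq nat) : all (leq 1) s -> size s <= sumn s.
Proof.
elim: s => //= i s IHs /andP[i_gt0 /IHs le_s].
by rewrite -add1n leq_add.
Qed.

Fact part_le_sumn (s : seq nat) (i : nat) : i \in s -> i <= sumn s.
Proof.
elim: s => //= j s IHs; rewrite inE => /orP[/eqP->|/IHs le_i].
  exact: leq_addr.
exact: leq_trans le_i (leq_addl _ _).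
Qed.

Fact partition_encK : pcancel enc dec.
Proof.
move=> l; have /and3P[_ l_gt0 /eqP sum_l] := valP l.
have le_l : size (val l) <= n by rewrite (leq_trans (size_le_sumn l_gt0)) ?sum_l.
rewrite /dec /enc /insub_bseq insubdK; last by rewrite -topredE /= size_map.
rewrite -map_comp map_id_in ?valK // => i l_i /=.
by rewrite inordK // ltnS (leq_trans (part_le_sumn l_i)) ?sum_l.
Qed.

HB.instance Definition _ : isFinite (partition_of n) :=
  PCanIsFinite partition_encK.

End Finiteness.

(* The parts are listed in weakly decreasing order; the default 0 only
   concerns the empty partition, which has no smallest part. *)
Definition smallest_part (s : seq nat) : nat := last 0 s.

Definition P_do (n : nat) : {set partition_of n} :=
  [set l : partition_of n | uniq l && odd (smallest_part l)].

(* Main.v *)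
(** Removing the largest possible part [N] shows that twice the signed
    generating polynomial of the partitions in question with parts at most [N],
    plus one, is [D_N(-q)], where
    [D_N(z) = \sum_(m <= N) z^m \prod_(m < i <= N) (1 - q^i)].  Since
    [(1 - z) D_N(z) = D_N(zq) - z^(N+1)], moving [z] from [-q] to [-q^(N+1)]
    gives [D_N(-q) (-q; q)_N = (q; q)_N] modulo [q^(N+1)].  A telescoping
    identity in the style of Shanks shows that
    [\sum_(-N <= k <= N) (-1)^k q^(k^2)] satisfies the same congruence, and the
    factor [(-q; q)_N], whose constant term is 1, can be cancelled. *)
Require Import Defs.
From mathcomp Require Import all_boot all_order all_algebra.
From mathcomp Require Import ring.

Set Implicit Arguments.
Unset Strict Implicit.
Unset Printing Implicit Defensive.

Import GRing.Theory.

(** * Enumeration of partitions into distinct parts *)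

Fixpoint distinct_parts (N : nat) : seq (seq nat) :=
  if N is N'.+1 then
    distinct_parts N' ++ [seq N :: s | s <- distinct_parts N']
  else [:: [::]].

Lemma mem_distinct_parts (N : nat) (s : seq nat) :
  (s \in distinct_parts N) = sorted gtn s && all (fun i => 0 < i <= N) s.
Proof.
elim: N s => [|N IHN] s /=.
  rewrite inE; case: s => [//|i s] /=.
  by case: i => [|i]; rewrite /= andbF.
have gtn_trans : transitive gtn by move=> y x z /= yx zy; apply: ltn_trans yx.
rewrite mem_cat IHN; case: s => [//|i s].
have -> : (i :: s \in [seq N.+1 :: t | t <- distinct_parts N])
          = (i == N.+1) && (s \in distinct_parts N).
  apply/mapP/andP => [[t t_in [-> ->]]|[/eqP-> s_in]]; first by rewrite eqxx.
  by exists s.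
rewrite IHN /= path_sortedE //.
(* Once the head [i] dominates the tail, the upper bound on the tail is automatic and only
   positivity remains. *)
have allE k : (i <= k.+1)%N -> all (gtn i) s ->
    all (fun j => 0 < j <= k) s = all (leq 1) s.
  move=> le_ik /allP lt_s; apply: eq_in_all => j /lt_s /= lt_ji.
  by rewrite -[(j <= k)%N]ltnS (leq_trans lt_ji le_ik) andbT.
case: (ltngtP i N.+1) => [lt_i|gt_i|eq_i] /=.
- rewrite orbF (_ : (i <= N)%N) // !andbT.
  have [lt_s|//] := boolP (all (gtn i) s).
  by rewrite !allE // ltnW // ltnW.
- by rewrite [(i <= N)%N]leqNgt (ltnW gt_i) /= !andbF.
- rewrite eq_i ltnn !andbF /= andbAC -all_predI [LHS]andbC.
  congr (_ && _); apply: eq_all => j /=; rewrite ltnS.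
  by case: (leqP j N) => [/leqW->|]; rewrite ?andbF ?andbT.
Qed.

Lemma distinct_parts_uniq (N : nat) : uniq (distinct_parts N).
Proof.
elim: N => [//|N IHN] /=.
rewrite cat_uniq IHN map_inj_uniq ?IHN ?andbT => [|s t [] //].
apply/hasPn => _ /mapP[s _ ->].
by rewrite mem_distinct_parts /= ltnn !andbF.
Qed.

Local Open Scope ring_scope.

(** Bounding the parts by [n] loses nothing, since a part never exceeds the sum; this trades the
    finite type for an explicit recursive list. *)
Lemma sum_P_do (n : nat) (F : seq nat -> int) :
  \sum_(l in P_do n) F l
  = \sum_(s <- distinct_parts n | odd (smallest_part s) && (sumn s == n)) F s.
Proof.
rewrite -big_enum -(big_map (@parts n) xpredT F) -[RHS]big_filter.
apply: perm_big; apply: uniq_perm.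
- by rewrite (map_inj_uniq val_inj) enum_uniq.
- by rewrite filter_uniq // distinct_parts_uniq.
have sortedE s : sorted gtn s = uniq s && sorted geq s.
  exact: gtn_sorted_uniq_geq.
move=> s; rewrite mem_filter mem_distinct_parts.
apply/mapP/idP => [[l]|].
  rewrite mem_enum inE => /andP[uniq_l odd_l] ->.
  have /and3P[sorted_l pos_l /eqP sum_l] := valP l.
  rewrite odd_l sum_l eqxx sortedE uniq_l sorted_l /=.
  apply/allP => i i_l; rewrite (allP pos_l) //=.
  by rewrite -[X in (_ <= X)%N]sum_l part_le_sumn.
move=> /andP[/andP[odd_s sum_s] /andP[]].
rewrite sortedE => /andP[uniq_s sorted_s] all_s.
have part_s : is_partition n s.
  rewrite /is_partition sorted_s sum_s andbT /=.
  by apply: sub_all all_s => i /andP[].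
by exists (PartitionOf part_s) => //; rewrite mem_enum inE uniq_s.
Qed.

(** * The signed generating polynomial *)

Definition do_poly (N : nat) : {poly int} :=
  \sum_(s <- distinct_parts N | odd (smallest_part s))
     (-1) ^+ size s *: 'X^(sumn s).

Lemma do_poly0 : do_poly 0 = 0.
Proof. by rewrite /do_poly big_cons big_nil. Qed.

Lemma do_polyS (N : nat) :
  do_poly N.+1
  = (1 - 'X^(N.+1)) * do_poly N - (if odd N.+1 then 'X^(N.+1) else 0).
Proof.
rewrite /do_poly /= big_cat big_map /= mulrBl mul1r -addrA; congr (_ + _).
(* Putting [N.+1] in front keeps the smallest part, except on the empty list: its default 0 is even,
   but it becomes [[:: N.+1]], whence the correction term for odd [N.+1]. *)
have nil_in : [::] \in distinct_parts N by rewrite mem_distinct_parts.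
rewrite big_mkcond /= !(big_rem _ nil_in) /= add0r.
rewrite addrC mulr_sumr -sumrN; congr (_ + _).
  rewrite [RHS]big_mkcond !big_seq; apply: eq_bigr => s s_in.
  have : s != [::].
    apply: contraTneq s_in => ->.
    by rewrite mem_rem_uniqF ?distinct_parts_uniq.
  case: s {s_in} => [//|i s] _; rewrite /smallest_part /=.
  case: ifP => _ //.
  by rewrite exprS mulN1r scaleNr -scalerAr exprD.
rewrite /smallest_part /= addn0 expr1 scaleN1r.
by case: ifP => _ //; rewrite oppr0.
Qed.

Lemma coef_do_poly (n : nat) :
  (do_poly n)`_n = \sum_(l in P_do n) (-1) ^+ size l.
Proof.
rewrite (sum_P_do _ (fun s => (-1) ^+ size s)) /do_poly coef_sum big_mkcondr /=.
apply: eq_bigr => s _; rewrite coefZ coefXn eq_sym.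
by case: (_ == _); rewrite ?mulr1 ?mulr0.
Qed.

(** * Finite q-series identities *)

Section QSeries.

Variable R : comNzRingType.
Implicit Types (q z : R) (n m s : nat).

(** For m <= n this is the quotient of (q; q)_n by (q; q)_m, kept free of division. Below, [qprodN]
    is (-q; q)_n, [qsum] is D_n(z), and [qtheta] is the two-sided theta sum with k and -k paired. *)
Definition qprod q m n : R := \prod_(m.+1 <= i < n.+1) (1 - q ^+ i).
Definition qprodN q n : R := \prod_(1 <= i < n.+1) (1 + q ^+ i).
Definition qsum q n z : R := \sum_(0 <= m < n.+1) z ^+ m * qprod q m n.
Definition qtheta q n : R :=
  1 + 2 * \sum_(1 <= k < n.+1) (-1) ^+ k * q ^+ (k ^ 2).

Lemma qprod_nil q n : qprod q n n = 1.
Proof. by rewrite /qprod big_geq. Qed.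

Lemma qprod_recr q m n :
  (m <= n)%N -> qprod q m n.+1 = qprod q m n * (1 - q ^+ n.+1).
Proof. by move=> le_mn; rewrite /qprod big_nat_recr. Qed.

Lemma qprod_recl q m n :
  (m < n)%N -> qprod q m n = (1 - q ^+ m.+1) * qprod q m.+1 n.
Proof. by move=> lt_mn; rewrite /qprod big_ltn. Qed.

Lemma qprodN0 q : qprodN q 0 = 1.
Proof. by rewrite /qprodN big_geq. Qed.

Lemma qprodNS q n : qprodN q n.+1 = qprodN q n * (1 + q ^+ n.+1).
Proof. by rewrite /qprodN big_nat_recr. Qed.

Lemma qsumS q n z : qsum q n.+1 z = (1 - q ^+ n.+1) * qsum q n z + z ^+ n.+1.
Proof.
rewrite /qsum big_nat_recr //= qprod_nil mulr1 mulr_sumr; congr (_ + _).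
rewrite !big_nat; apply: eq_bigr => m; rewrite ltnS => /= le_mn.
by rewrite qprod_recr //; ring.
Qed.

Lemma qsum_shift q n z :
  (1 - z) * qsum q n z = qsum q n (z * q) - z ^+ n.+1.
Proof.
elim: n => [|n IHn].
  by rewrite /qsum !big_nat1 qprod_nil; ring.
rewrite !qsumS mulrDr mulrCA IHn exprMn !exprS; ring.
Qed.

(** An exact form of the theta congruence: each term of the remainder carries [q ^+ (s.+1 * n.+1)],
    a multiple of [q ^+ n.+1]. *)
Lemma shanks_theta q n :
  qtheta q n * qprodN q n
  = qprod q 0 n + 2 * \sum_(0 <= s < n)
      (-1) ^+ s.+1 * q ^+ (s.+1 * n.+1) * qprodN q s * qprod q s.+1 n.
Proof.
elim: n => [|n IHn].
  by rewrite /qtheta qprodN0 qprod_nil !big_geq // mulr0 mulr1.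
(* Telescoping certificate: passing from [n] to [n.+1], each summand is multiplied by
   [1 + q ^+ n.+1] up to a difference of [u]. The end [u 0] corrects [qprod q 0 n], while [u n] and
   the new summand [s = n] yield the new theta term. *)
pose u s := (-1) ^+ s * q ^+ (s.+1 * n.+1) * qprodN q s * qprod q s n.
have -> : qtheta q n.+1 * qprodN q n.+1 = (1 + q ^+ n.+1) *
    (qtheta q n * qprodN q n)
    + 2 * ((-1) ^+ n.+1 * q ^+ (n.+1 ^ 2) * qprodN q n.+1).
  by rewrite /qtheta big_nat_recr //= qprodNS; ring.
rewrite IHn [in RHS]big_nat_recr //= qprod_nil mulr1.
have -> : \sum_(0 <= s < n)
      (-1) ^+ s.+1 * q ^+ (s.+1 * n.+2) * qprodN q s * qprod q s.+1 n.+1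
    = (1 + q ^+ n.+1) * (\sum_(0 <= s < n)
      (-1) ^+ s.+1 * q ^+ (s.+1 * n.+1) * qprodN q s * qprod q s.+1 n)
      - \sum_(0 <= s < n) (u s.+1 - u s).
  rewrite mulr_sumr -sumrB !big_nat; apply: eq_bigr => s /= lt_sn.
  rewrite /u qprod_recr // (qprod_recl _ lt_sn) qprodNS.
  rewrite [(s.+1 * n.+2)%N]mulnS [(s.+2 * n.+1)%N]mulSn !exprD !exprS.
  ring.
rewrite telescope_sumr // /u qprod_nil qprod_recr // qprodNS mul1n.
rewrite -mulnn [(n.+1 * n.+2)%N]mulnS !exprD qprodN0 expr0.
rewrite [(-1) ^+ n.+1]exprS; ring.
Qed.

End QSeries.

(** * Comparison modulo powers of ['X] *)

Lemma do_poly_qsum (n : nat) : 2 * do_poly n + 1 = qsum 'X n (- 'X).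
Proof.
elim: n => [|n IHn].
  by rewrite do_poly0 /qsum big_nat1 qprod_nil; ring.
(* Doubling and adding 1 turns the parity condition into a sign: 1 - 2 [n+1 odd] = (-1)^(n+1). *)
rewrite qsumS -IHn do_polyS [in RHS]exprNn -signr_odd /=.
case: (odd n) => /=; rewrite ?expr0 ?expr1; ring.
Qed.

(** By strong induction, coefficient [i] of [u * p] reduces to that of [p], the lower ones being
    already zero. *)
Lemma coef_mul0_cancel (R : nzRingType) (m : nat) (u p : {poly R}) :
  u`_0 = 1 -> (forall i, (i < m)%N -> (u * p)`_i = 0) ->
  forall i, (i < m)%N -> p`_i = 0.
Proof.
move=> u0 up0; elim/ltn_ind => i IHi lt_im.
have := up0 i lt_im; rewrite coefM big_ord_recl subn0 u0 mul1r.
rewrite big1 ?addr0 // => j _ /=; rewrite IHi ?mulr0 //.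
  by rewrite /bump /= add1n ltn_subrL (leq_ltn_trans _ (ltn_ord j)).
by rewrite (leq_ltn_trans (leq_subr _ _)).
Qed.

Definition Xdvd (R : nzRingType) (m : nat) (p : {poly R}) :=
  exists r, p = r * 'X^m.

Section Xdvd.

Variables (R : comNzRingType) (m : nat).
Implicit Types p r : {poly R}.

Lemma Xdvd_coef p i : Xdvd m p -> (i < m)%N -> p`_i = 0.
Proof. by move=> [r ->] lt_im; rewrite coefMXn lt_im. Qed.

Lemma Xdvd0 : Xdvd m (0 : {poly R}).
Proof. by exists 0; rewrite mul0r. Qed.

Lemma XdvdD p r : Xdvd m p -> Xdvd m r -> Xdvd m (p + r).
Proof. by move=> [a ->] [b ->]; exists (a + b); rewrite mulrDl. Qed.

Lemma XdvdMl p r : Xdvd m p -> Xdvd m (r * p).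
Proof. by move=> [a ->]; exists (r * a); rewrite mulrA. Qed.

Lemma Xdvd_Xn k : (m <= k)%N -> Xdvd m ('X^k : {poly R}).
Proof. by move=> le_mk; exists 'X^(k - m); rewrite -exprD subnK. Qed.

Lemma Xdvd_sum (I : Type) (r : seq I) (P : pred I) (F : I -> {poly R}) :
  (forall i, P i -> Xdvd m (F i)) -> Xdvd m (\sum_(i <- r | P i) F i).
Proof. by move=> dvdF; elim/big_ind: _ => //; [exact: Xdvd0 | exact: XdvdD]. Qed.

End Xdvd.

Lemma qsum_qprodN (R : comNzRingType) (n : nat) :
  Xdvd n.+1 (qprodN 'X n * qsum 'X n (- 'X) - qprod 'X 0 n : {poly R}).
Proof.
have XNn i k : (0 < i)%N -> (n < k)%N -> Xdvd n.+1 ((- 'X^i) ^+ k : {poly R}).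
  move=> i_gt0 lt_nk; rewrite exprNn; apply: XdvdMl; rewrite -exprM.
  by apply: Xdvd_Xn; rewrite (leq_trans lt_nk) ?leq_pmull.
(* Applying [qsum_shift] [k] times moves z from -X to -X^(k+1); each application errs by z^(n+1), a
   multiple of X^(n+1). *)
have shift k :
    Xdvd n.+1 (qprodN 'X k * qsum 'X n (- 'X) - qsum 'X n (- 'X^(k.+1)) : {poly R}).
  elim: k => [|k IHk]; first by rewrite qprodN0 mul1r subrr; apply: Xdvd0.
  have := qsum_shift ('X : {poly R}) n (- 'X^(k.+1)); rewrite opprK.
  rewrite mulNr -exprSr => shift_k.
  have -> : qprodN 'X k.+1 * qsum 'X n (- 'X) - qsum 'X n (- 'X^(k.+2))
    = (1 + 'X^(k.+1)) * (qprodN 'X k * qsum 'X n (- 'X) - qsum 'X n (- 'X^(k.+1)))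
      + -1 * (- 'X^(k.+1)) ^+ n.+1 :> {poly R}.
    by rewrite qprodNS mulrBr shift_k; ring.
  by apply: XdvdD; apply: XdvdMl => //; apply: XNn.
(* At z = -X^(n+1) only the term of index 0, namely [qprod 'X 0 n], survives modulo X^(n+1). *)
have -> : qprodN 'X n * qsum 'X n (- 'X) - qprod 'X 0 n
  = (qprodN 'X n * qsum 'X n (- 'X) - qsum 'X n (- 'X^(n.+1)))
    + \sum_(0 <= m < n) (- 'X^(n.+1)) ^+ m.+1 * qprod 'X m.+1 n :> {poly R}.
  rewrite [X in _ - X + _]/qsum big_nat_recl // expr0 mul1r.
  by ring.
apply: XdvdD => //; apply: Xdvd_sum => m _; rewrite mulrC; apply: XdvdMl.
rewrite exprNn; apply: XdvdMl; rewrite -exprM.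
by apply: Xdvd_Xn; rewrite leq_pmulr.
Qed.

Lemma qtheta_qprodN (R : comNzRingType) (n : nat) :
  Xdvd n.+1 (qprodN 'X n * qtheta 'X n - qprod 'X 0 n : {poly R}).
Proof.
rewrite mulrC shanks_theta [X in Xdvd _ X]addrAC subrr add0r.
apply: XdvdMl; apply: Xdvd_sum => s _.
rewrite -mulrA mulrAC; apply: XdvdMl; apply: Xdvd_Xn.
by rewrite leq_pmull.
Qed.

Lemma coef_qprodN0 (R : comNzRingType) (n : nat) :
  (qprodN 'X n : {poly R})`_0 = 1.
Proof.
elim: n => [|n IHn]; first by rewrite qprodN0 coef1.
by rewrite qprodNS coefM big_ord1 IHn coefD coef1 coefXn addr0 mulr1.
Qed.

Lemma coef_do_poly_squares (n : nat) :
  (do_poly n)`_n = \sum_(1 <= k < n.+1) if n == (k ^ 2)%N then (-1) ^+ k else 0.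
Proof.
pose p := \sum_(1 <= k < n.+1) (-1) ^+ k * 'X^(k ^ 2) : {poly int}.
have pE : p`_n = \sum_(1 <= k < n.+1) if n == (k ^ 2)%N then (-1) ^+ k else 0.
  rewrite coef_sum; apply: eq_bigr => k _.
  rewrite -[(-1) ^+ k]/((-1) ^+ k : {poly int}) -(rmorphN1 (@polyC int)).
  rewrite -rmorphXn /= coefCM coefXn.
  by case: eqP => _; rewrite ?mulr1 ?mulr0.
(* The factor 2 matches the pairing in [qtheta] and is cancellable in [int]. *)
suff : (2 * (do_poly n - p))`_n = 0.
  rewrite -(rmorph_nat (@polyC int)) coefCM coefB pE => /eqP.
  by rewrite mulf_eq0 /= subr_eq0 => /eqP.
have -> : 2 * (do_poly n - p) = qsum 'X n (- 'X) - qtheta 'X n.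
  by rewrite -do_poly_qsum /qtheta -/p; ring.
(* The modulus X^(n+1) is just large enough to reach coefficient [n]. *)
apply: (@coef_mul0_cancel _ n.+1 (qprodN 'X n)) => //.
  exact: coef_qprodN0.
move=> i; apply: Xdvd_coef.
have -> : qprodN 'X n * (qsum 'X n (- 'X) - qtheta 'X n)
  = (qprodN 'X n * qsum 'X n (- 'X) - qprod 'X 0 n)
    + -1 * (qprodN 'X n * qtheta 'X n - qprod 'X 0 n) :> {poly int} by ring.
apply: XdvdD; first exact: qsum_qprodN.
by apply: XdvdMl; apply: qtheta_qprodN.
Qed.

Theorem theorem3p1 (n : nat) (hn : (0 < n)%N) :
  (forall k : nat, (0 < k)%N -> n = (k ^ 2)%N ->
     \sum_(l in P_do n) (-1) ^+ size l = (-1) ^+ k :> int) /\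
  ((~ exists k : nat, (0 < k)%N /\ n = (k ^ 2)%N) ->
     \sum_(l in P_do n) (-1) ^+ size l = 0%R :> int).
Proof.
rewrite -coef_do_poly coef_do_poly_squares; split=> [k k_gt0 nE|not_square].
  (* The root [k] lies in the range because k <= k^2 = n; squaring is injective, so no other index
     contributes. *)
  rewrite (bigD1_seq k) ?iota_uniq //=; last first.
    by rewrite mem_index_iota k_gt0 ltnS nE -mulnn leq_pmull.
  rewrite nE eqxx big1 ?addr0 // => j ne_jk.
  by rewrite eqn_exp2r // eq_sym (negPf ne_jk).
rewrite big_nat big1 // => k /andP[k_gt0 _].
by case: eqP => // nE; case: not_square; exists k.
Qed.
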